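(* Let $n\ge m$ be positive integers, let $f:\mathbb{R}^{m\times n}\to\mathbb{R}$ be proper and $L$-smooth for some $L>0$, have a unique global minimizer $x^\star$, and satisfy a global Polyak-Łojasiewicz inequality with constant $\mu>0$. Let $\varepsilon>0$ and $x_0\in\mathbb{R}^{m\times n}$, and consider the Soft Muon iteration $$H_k=\beta H_{k-1}+(1-\beta)\nabla f(x_{k-1}),\qquad x_k=x_{k-1}-\alpha\,(H_kH_k^\top+\varepsilon^2I)^{-1/2}H_k,\qquad k\ge1,$$ started from $(x_0,H_0)$ with $H_0=\nabla f(x_0)$. Let $\beta^\star=1/\sqrt2$. Then for every $\beta\in[0,\beta^\star)$ there exists $\bar\alpha(\beta)>0$ such that for every $\alpha\in(0,\bar\alpha(\beta))$ the sequences $\{x_k\}$ and $\{H_k\}$ are bounded and $$\lim_{k\to\infty}\|\nabla f(x_k)\|=0.$$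
   Context: $\|\cdot\|$ denotes the Frobenius norm and $\nabla f$ is the gradient with respect to the Frobenius inner product. $f$ is proper if preimages of compact sets are compact. $f$ is $L$-smooth if it is differentiable and $\|\nabla f(x)-\nabla f(y)\|\le L\|x-y\|$ for all $x,y$. The global Polyak-Łojasiewicz inequality with constant $\mu$ means $\|\nabla f(x)\|^2\ge\mu(f(x)-f^\star)$ for all $x\in\mathbb{R}^{m\times n}$, where $f^\star=\min f=f(x^\star)$. $(\cdot)^{-1/2}$ is the inverse of the symmetric positive definite square root. The threshold $\bar\alpha(\beta)$ may depend on $f$, $\varepsilon$ and $x_0$. *)

(* Defs.v *)
From HB Require Import structures.
From mathcomp Require Import all_boot all_order all_algebra.
From mathcomp Require Import all_classical all_reals all_analysis.
Set Implicit Arguments.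
Unset Strict Implicit.
Unset Printing Implicit Defensive.
Import Order.TTheory GRing.Theory Num.Theory.
Import numFieldNormedType.Exports.
Local Open Scope classical_set_scope.
Local Open Scope ring_scope.

Section Defs.
Context {R : realType}.

(* The library norm `|A| on matrices is the sup norm of the entries, so the
   Frobenius structure is defined here. The two norms are equivalent, hence the
   library topology, compactness and differentiability on 'M[R]_(m, n) are the
   usual ones. *)
Definition frob_dot m n (A B : 'M[R]_(m, n)) : R := \tr (A *m B^T).

Definition frob_norm m n (A : 'M[R]_(m, n)) : R := Num.sqrt (frob_dot A A).

Definition grad m n (f : 'M[R]_(m, n) -> R) (x : 'M[R]_(m, n)) : 'M[R]_(m, n) :=
  \matrix_(i, j) 'd f x (delta_mx i j).

Lemma diff_grad m n (f : 'M[R]_(m, n) -> R) (x h : 'M[R]_(m, n)) :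
  'd f x h = frob_dot (grad f x) h.
Proof.
rewrite [in LHS](matrix_sum_delta h) linear_sum /frob_dot /mxtrace.
apply: eq_bigr => i _; rewrite linear_sum !mxE.
by apply: eq_bigr => j _; rewrite linearZ !mxE mulrC.
Qed.

Definition proper_fun m n (f : 'M[R]_(m, n) -> R) : Prop :=
  forall K : set R, compact K -> compact (f @^-1` K).

Definition L_smooth m n (L : R) (f : 'M[R]_(m, n) -> R) : Prop :=
  (forall x, differentiable f x) /\
  (forall x y, frob_norm (grad f x - grad f y) <= L * frob_norm (x - y)).

Definition global_minimizer m n (f : 'M[R]_(m, n) -> R) (x : 'M[R]_(m, n)) : Prop :=
  forall y, f x <= f y.

Definition PL_ineq m n (mu : R) (f : 'M[R]_(m, n) -> R) (fstar : R) : Prop :=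
  forall x, frob_norm (grad f x) ^+ 2 >= mu * (f x - fstar).

Definition spd m (A : 'M[R]_m) : Prop :=
  A^T = A /\ forall v : 'cV[R]_m, v != 0 -> 0 < (v^T *m A *m v) 0 0.

(* A symmetric positive definite A has exactly one symmetric positive definite
   square root; the default 0 is only returned for other matrices A. *)
Definition spd_sqrt m (A : 'M[R]_m) : 'M[R]_m :=
  xget 0 [set S | spd S /\ S *m S = A].

Definition inv_sqrt m (A : 'M[R]_m) : 'M[R]_m := invmx (spd_sqrt A).

Definition soft_muon m n (f : 'M[R]_(m, n) -> R) (eps alpha beta : R)
    (x0 : 'M[R]_(m, n)) (x H : nat -> 'M[R]_(m, n)) : Prop :=
  [/\ x 0%N = x0,
      H 0%N = grad f x0,
      forall k, H k.+1 = beta *: H k + (1 - beta) *: grad f (x k) &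
      forall k, x k.+1 =
        x k - alpha *: (inv_sqrt (H k.+1 *m (H k.+1)^T + (eps ^+ 2)%:M) *m H k.+1)].

Definition frob_bounded m n (u : nat -> 'M[R]_(m, n)) : Prop :=
  exists M : R, forall k, frob_norm (u k) <= M.

End Defs.

(* Main.v *)
Require Import Defs.
From HB Require Import structures.
From mathcomp Require Import all_boot all_order all_algebra.
From mathcomp Require Import all_classical all_reals all_analysis.
From mathcomp Require Import complex ring lra.
Set Implicit Arguments.
Unset Strict Implicit.
Import Order.TTheory GRing.Theory Num.Theory.
Import numFieldNormedType.Exports.
Local Open Scope classical_set_scope.
Local Open Scope ring_scope.

(** Write g_k for the gradient at x_k, P(H) = (H H^T + eps^2 I)^(-1/2) H for
    the soft polar factor, p_k for the squared norm of P(H_(k+1)), and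
    e_k = H_(k+1) - g_k for the momentum error, with squared norm q_k.

    Along the step -P(H) the objective decreases up to the error: P satisfies
    <H, P(H)> >= eps |P(H)|^2 (soft_polar_dot_ge), because S = (H H^T +
    eps^2 I)^(1/2) is at least eps I and H = S P(H).  The descent inequality
    then gives, to first order in alpha, a decrease of
    alpha eps p_k - alpha <e_k, P(H_(k+1))>.  The error contracts: the choice
    H_0 = g_0 makes e_0 = 0, and e_(k+1) = beta (e_k + g_k - g_(k+1)), where the
    gradient increment has norm at most L alpha sqrt p_k; hence q_k contracts by
    the factor beta up to O(alpha^2) p_k (sq_errorS).

    Both effects combine in the Lyapunov function
    V_k = f(x_k) + alpha / (eps (1 - beta)) q_k.  If alpha L <= eps (1 - beta) / 8,
    then V_(k+1) <= V_k - alpha (eps p_k / 4 + q_k / (2 eps))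
    (lyapunov_decrease).  So f(x_k) <= V_k <= V_0 = f(x_0), and properness
    confines the iterates to a compact sublevel set; gradients and momenta,
    which are averages of gradients, stay bounded.  As V is also bounded below,
    its decrements tend to 0, so p_k and q_k tend to 0.  Finally
    |H|^2 <= (|H|^2 + m eps^2) |P(H)|^2 (soft_polar_inv_bound) turns p_k -> 0 into
    H_k -> 0 on bounded momenta, and g_k = H_(k+1) - e_k -> 0.

    The matrix square root is obtained from the spectral theorem over the
    complex extension of R, descending to real matrices through an
    interpolation polynomial (spd_has_sqrt). *)

(** * Square roots of symmetric positive definite matrices *)

Lemma exists_interpolation_poly (F : fieldType) (g : F -> F) (s : seq F) :
  exists p : {poly F}, forall a, a \in s -> p.[a] = g a.
Proof.
elim: s => [|b s [p pE]]; first by exists 0.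
have [bs|bs] := boolP (b \in s).
  by exists p => a; rewrite inE => /predU1P[->|]; exact: pE.
pose w := \prod_(c <- s) ('X - c%:P).
have wb : w.[b] != 0.
  by move: bs; rewrite -root_prod_XsubC.
exists (p + ((g b - p.[b]) / w.[b]) *: w) => a; rewrite inE hornerD hornerZ.
case/predU1P => [->|as_]; first by rewrite divfK// addrC subrK.
have /rootP -> : root w a by rewrite root_prod_XsubC.
by rewrite mulr0 addr0 pE.
Qed.

(** Diagonalizability of a symmetric matrix in a form that mentions only real
    objects.  Over the complex extension A is hermitian, hence unitarily similar
    to a diagonal matrix with real entries; these entries are the sequence s,
    and p(A) is similar to the diagonal matrix of the values of p on s. *)
Lemma symmetric_annihilating_spectrum (R : rcfType) m (A : 'M[R]_m.+1) : A^T = A ->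
  exists2 s : seq R, {in s, forall a, eigenvalue A a} &
    forall p : {poly R}, {in s, forall a, root p a} -> horner_mx A p = 0.
Proof.
move=> symA; pose toC : {rmorphism R -> R[i]} := real_complex R.
pose AC := map_mx toC A.
have hermAC : AC \is hermsymmx.
  apply: realsym_hermsym.
    by apply/is_hermitianmxP; rewrite expr0 scale1r map_mx_id// /AC map_trmx symA.
  by apply/mxOverP => i j; rewrite mxE; apply/complex_realP; exists (A i j).
have /orthomx_spectralP := hermitian_normalmx hermAC.
set P := spectralmx AC; set d := spectral_diag AC => ACE.
have uP : P \in unitmx by exact: spectral_unit.
pose r j := complex.Re (d 0 j).
have dE j : d 0 j = toC (r j).
  have /mxOverP/(_ 0 j) := hermitian_spectral_diag_real hermAC.
  by move/RRe_real.
exists [seq r j | j <- enum 'I_m.+1].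
  move=> _ /mapP[j _ ->]; rewrite -(eigenvalue_map toC) -/AC.
  apply/eigenvalueP; exists (row j P).
    rewrite [AC]ACE !mulmxA -row_mul mulmxV// row1 -rowE row_diag_mx.
    by rewrite -scalemxAl -rowE dE.
  apply: contraTneq uP => Pj0; rewrite -row_free_unit.
  by apply/row_freePn; exists j; rewrite Pj0 sub0mx.
move=> p rootp; apply/eqP; rewrite -(map_mx_eq0 toC) map_horner_mx -/AC [AC]ACE.
rewrite horner_mx_uconjC// horner_mx_diag.
suff -> : map_mx (horner (map_poly toC p)) d = 0.
  by rewrite linear0 mulmx0 mul0mx.
apply/matrixP => i j; rewrite !mxE ord1 dE horner_map (rootP _) ?rmorph0//.
by apply: rootp; rewrite map_f// mem_enum.
Qed.

Lemma trmx_horner_mx (R : comNzRingType) m (A : 'M[R]_m.+1) (p : {poly R}) :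
  A^T = A -> (horner_mx A p)^T = horner_mx A p.
Proof.
move=> symA; elim/poly_ind: p => [|p c IH]; first by rewrite rmorph0 linear0.
rewrite rmorphD rmorphM /= horner_mx_X horner_mx_C linearD /= tr_scalar_mx.
congr (_ + _); rewrite -mulmxE trmx_mul symA IH.
by apply: comm_mx_sym; exact: comm_horner_mx.
Qed.

Section SquareRoot.
Context {R : realType}.

Lemma gram_gt0 m (v : 'cV[R]_m) : v != 0 -> 0 < (v^T *m v) 0 0.
Proof.
move=> v0; rewrite mxE lt_neqAle sumr_ge0 ?andbT; last first.
  by move=> i _; rewrite mxE -expr2 sqr_ge0.
rewrite eq_sym; apply: contra v0 => /eqP sum0.
apply/eqP/matrixP => i j; rewrite ord1 mxE; apply/eqP.
move/eqP: sum0; rewrite psumr_eq0 => [/allP/(_ i (mem_index_enum i))|k _].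
  by rewrite mxE -expr2 sqrf_eq0.
by rewrite mxE -expr2 sqr_ge0.
Qed.

Lemma spd_eigenvalue_gt0 m (A : 'M[R]_m) a : spd A -> eigenvalue A a -> 0 < a.
Proof.
move=> [_ Apos] /eigenvalueP[v vA v0].
have vT0 : v^T != 0 by rewrite trmx_eq0.
have := Apos _ vT0; rewrite trmxK vA -scalemxAl mxE.
by rewrite pmulr_lgt0//; move: (gram_gt0 vT0); rewrite trmxK.
Qed.

Lemma spd_unitmx m (A : 'M[R]_m) : spd A -> A \in unitmx.
Proof.
move=> [_ Apos]; rewrite -unitmx_tr -row_free_unit -kermx_eq0.
apply: contraT => /rowV0Pn[v /sub_kermxP vA v0].
have := Apos v^T; rewrite trmx_eq0 => /(_ v0).
by rewrite -mulmxA -(trmxK A) -trmx_mul vA linear0 mulmx0 mxE ltxx.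
Qed.

(** Take T = q(A), where q interpolates the fourth root on the spectrum of A.
    Then T^4 = A, so T^2 is a square root of A; being the square of an invertible
    symmetric matrix, it is positive definite.  This is why fourth roots are
    interpolated: a square root of A that is merely symmetric would not do. *)
Lemma spd_has_sqrt m (A : 'M[R]_m) :
  spd A -> exists S : 'M[R]_m, spd S /\ S *m S = A.
Proof.
case: m A => [|m] A spdA; first by exists A; rewrite [A *m A]flatmx0 [RHS]flatmx0.
have [symA _] := spdA.
pose root4 (a : R) := Num.sqrt (Num.sqrt a).
have [d evd annd] := symmetric_annihilating_spectrum symA.
have [q qE] := exists_interpolation_poly root4 d.
set T := horner_mx A q.
have symT : T^T = T by exact: trmx_horner_mx.
have T4 : T *m T *m (T *m T) = A.
  apply/eqP; rewrite -subr_eq0; apply/eqP.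
  rewrite -[X in _ - X]horner_mx_X !mulmxE -!rmorphM -rmorphB /=.
  apply: annd => a da; apply/rootP; have ea := evd a da.
  have a0 := ltW (spd_eigenvalue_gt0 spdA ea).
  have root4E : root4 a * root4 a = Num.sqrt a.
    by rewrite -expr2 sqr_sqrtr// sqrtr_ge0.
  by rewrite hornerD hornerN hornerX !hornerM qE// root4E -expr2 sqr_sqrtr ?subrr.
exists (T *m T); split=> //; split; first by rewrite trmx_mul symT.
move=> v v0.
have Tv0 : T *m v != 0.
  apply: contra_neq v0 => Tv.
  rewrite -[v](mulKmx (spd_unitmx spdA)) -[in X in _ *m X]T4.
  by rewrite -!mulmxA Tv !mulmx0.
by have := gram_gt0 Tv0; rewrite trmx_mul symT !mulmxA.
Qed.

Lemma spd_sqrtP m (A : 'M[R]_m) :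
  spd A -> spd (spd_sqrt A) /\ spd_sqrt A *m spd_sqrt A = A.
Proof. by move=> /spd_has_sqrt hS; exact: (xgetPex 0 hS). Qed.

End SquareRoot.

(** * The Frobenius inner product *)

Section Frobenius.
Context {R : realType}.

Lemma frob_dotE m n (A B : 'M[R]_(m, n)) :
  frob_dot A B = \sum_i \sum_j A i j * B i j.
Proof.
by apply: eq_bigr => i _; rewrite mxE; apply: eq_bigr => j _; rewrite mxE.
Qed.

Lemma frob_dotC m n (A B : 'M[R]_(m, n)) : frob_dot A B = frob_dot B A.
Proof. by rewrite /frob_dot -mxtrace_tr trmx_mul trmxK. Qed.

Lemma frob_dotDl m n (A B C : 'M[R]_(m, n)) :
  frob_dot (A + B) C = frob_dot A C + frob_dot B C.
Proof. by rewrite /frob_dot mulmxDl mxtraceD. Qed.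

Lemma frob_dotZl m n a (A B : 'M[R]_(m, n)) :
  frob_dot (a *: A) B = a * frob_dot A B.
Proof. by rewrite /frob_dot -scalemxAl mxtraceZ. Qed.

Lemma frob_dotDr m n (A B C : 'M[R]_(m, n)) :
  frob_dot A (B + C) = frob_dot A B + frob_dot A C.
Proof. by rewrite ![frob_dot A _]frob_dotC frob_dotDl. Qed.

Lemma frob_dotZr m n a (A B : 'M[R]_(m, n)) :
  frob_dot A (a *: B) = a * frob_dot A B.
Proof. by rewrite ![frob_dot A _]frob_dotC frob_dotZl. Qed.

Lemma frob_dotMl m n p (A : 'M[R]_(m, p)) (B : 'M[R]_(p, n)) (C : 'M[R]_(m, n)) :
  frob_dot (A *m B) C = frob_dot B (A^T *m C).
Proof. by rewrite /frob_dot trmx_mul trmxK -mulmxA mxtrace_mulC mulmxA. Qed.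

Lemma frob_ge0 m n (A : 'M[R]_(m, n)) : 0 <= frob_dot A A.
Proof.
by rewrite frob_dotE; do 2!apply: sumr_ge0 => ? _; rewrite -expr2 sqr_ge0.
Qed.

Lemma frob_normX2 p q (A : 'M[R]_(p, q)) : frob_norm A ^+ 2 = frob_dot A A.
Proof. by rewrite sqr_sqrtr ?frob_ge0. Qed.

Lemma spd_frob_ge0 m n (S : 'M[R]_m) (H : 'M[R]_(m, n)) :
  spd S -> 0 <= frob_dot (S *m H) H.
Proof.
move=> [_ Spos]; rewrite /frob_dot mxtrace_mulC.
apply: sumr_ge0 => j _.
have -> : (H^T *m (S *m H)) j j = ((col j H)^T *m S *m col j H) 0 0.
  rewrite -mulmxA !mxE; apply: eq_bigr => k _; rewrite !mxE; congr (_ * _).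
  by apply: eq_bigr => l _; rewrite mxE.
have [->|/Spos/ltW//] := eqVneq (col j H) 0.
by rewrite mulmx0 mxE.
Qed.

(** The usual discriminant argument for the form (X, Y) |-> <S X, Y>, which is
    symmetric and positive semidefinite.  The case S = 1 is the Cauchy-Schwarz
    inequality for the Frobenius inner product; S = (H H^T + eps^2 I)^(1/2) gives
    the key estimate on the soft polar factor. *)
Lemma psd_cauchy_schwarz m n (S : 'M[R]_m) (X Y : 'M[R]_(m, n)) :
  S^T = S -> (forall Z : 'M[R]_(m, n), 0 <= frob_dot (S *m Z) Z) ->
  frob_dot (S *m X) Y ^+ 2 <= frob_dot (S *m X) X * frob_dot (S *m Y) Y.
Proof.
move=> symS psdS; set a := frob_dot _ X; set b := frob_dot _ Y.
set c := frob_dot _ Y.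
have quad t : 0 <= a + 2 * t * b + t ^+ 2 * c.
  have := psdS (X + t *: Y).
  rewrite mulmxDr -scalemxAr !(frob_dotDl, frob_dotDr, frob_dotZl, frob_dotZr).
  have -> : frob_dot (S *m Y) X = b by rewrite frob_dotMl symS frob_dotC.
  by rewrite -/a -/b -/c; nra.
have := psdS Y; rewrite -/c le_eqVlt => /predU1P[c0|c_gt0].
  rewrite -c0 mulr0.
  have [->|b0] := eqVneq b 0; first by rewrite expr0n.
  (* For c = 0 the quadratic is affine in t; this t makes it equal to -1. *)
  have := quad (- (a + 1) / (2 * b)); rewrite -c0 mulr0.
  have -> : 2 * (- (a + 1) / (2 * b)) * b = - (a + 1) by field.
  lra.
have := quad (- b / c).
have -> : a + 2 * (- b / c) * b + (- b / c) ^+ 2 * c = (a * c - b ^+ 2) / c.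
  by field; rewrite gt_eqF.
by rewrite pmulr_lge0 ?invr_gt0// subr_ge0.
Qed.

Lemma frob_cauchy_schwarz m n (A B : 'M[R]_(m, n)) :
  frob_dot A B ^+ 2 <= frob_dot A A * frob_dot B B.
Proof.
rewrite -[A in frob_dot A]mul1mx -[B in _ * frob_dot B _]mul1mx.
apply: psd_cauchy_schwarz; first by rewrite tr_scalar_mx.
by move=> Z; rewrite mul1mx frob_ge0.
Qed.

(** The entry (i, j) of A B is the inner product of row i of A and column j of B,
    so Cauchy-Schwarz bounds its square, and the bounds add up to the product of
    the two squared norms. *)
Lemma frob_mulmx_le m n p (A : 'M[R]_(m, p)) (B : 'M[R]_(p, n)) :
  frob_dot (A *m B) (A *m B) <= frob_dot A A * frob_dot B B.
Proof.
have rowsE k l (C : 'M[R]_(k, l)) :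
    frob_dot C C = \sum_i frob_dot (row i C) (row i C).
  rewrite frob_dotE; apply: eq_bigr => i _; rewrite frob_dotE big_ord1.
  by apply: eq_bigr => j _; rewrite !mxE.
have -> : frob_dot B B = frob_dot B^T B^T.
  by rewrite /frob_dot trmxK mxtrace_mulC.
rewrite (rowsE _ _ A) (rowsE _ _ B^T) frob_dotE mulr_suml.
apply: ler_sum => i _; rewrite mulr_sumr; apply: ler_sum => j _.
rewrite -expr2; suff -> : (A *m B) i j = frob_dot (row i A) (row j B^T).
  exact: frob_cauchy_schwarz.
by rewrite mxE frob_dotE big_ord1; apply: eq_bigr => k _; rewrite !mxE.
Qed.

Section Convexity.
Context {m n : nat}.
Implicit Types A B : 'M[R]_(m, n).

Lemma frob_lincomb A B (s t : R) :
  frob_dot (s *: A + t *: B) (s *: A + t *: B) =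
  s ^+ 2 * frob_dot A A + 2 * s * t * frob_dot A B + t ^+ 2 * frob_dot B B.
Proof.
rewrite !(frob_dotDl, frob_dotDr, frob_dotZl, frob_dotZr) [frob_dot B A]frob_dotC.
by move: (frob_dot A A) (frob_dot A B) (frob_dot B B) => a b c; ring.
Qed.

Lemma frob_convex A B (t : R) : 0 <= t <= 1 ->
  frob_dot (t *: A + (1 - t) *: B) (t *: A + (1 - t) *: B) <=
  t * frob_dot A A + (1 - t) * frob_dot B B.
Proof.
move=> /andP[t0 t1]; have := frob_ge0 (1 *: A + -1 *: B).
rewrite !frob_lincomb.
move: (frob_dot A A) (frob_dot A B) (frob_dot B B) => a b c ge0.
rewrite -subr_ge0.
have -> : t * a + (1 - t) * c - (t ^+ 2 * a + 2 * t * (1 - t) * b + (1 - t) ^+ 2 * c)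
  = t * (1 - t) * (1 ^+ 2 * a + 2 * 1 * -1 * b + (-1) ^+ 2 * c) by ring.
by rewrite !mulr_ge0// subr_ge0.
Qed.

Lemma frob_young A B (c : R) : 0 < c ->
  frob_dot A B <= (frob_dot A A / c + c * frob_dot B B) / 2.
Proof.
move=> c0; have := frob_ge0 (1 *: A + - c *: B); rewrite frob_lincomb.
move: (frob_dot A A) (frob_dot A B) (frob_dot B B) => a b d ge0.
rewrite -subr_ge0.
have -> : (a / c + c * d) / 2 - b =
    (1 ^+ 2 * a + 2 * 1 * - c * b + (- c) ^+ 2 * d) / (2 * c).
  by field; rewrite gt_eqF.
by rewrite divr_ge0// mulr_ge0// ltW.
Qed.

Lemma frob_addr_le A B :
  frob_dot (A + B) (A + B) <= 2 * frob_dot A A + 2 * frob_dot B B.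
Proof.
have := frob_ge0 (1 *: A + -1 *: B).
have -> : A + B = 1 *: A + 1 *: B by rewrite !scale1r.
rewrite !frob_lincomb.
move: (frob_dot A A) (frob_dot A B) (frob_dot B B) => a b c; lra.
Qed.

(** Links the sup norm, in which compact sets are bounded, to the Frobenius
    norm. *)
Lemma frob_normr_bound A (M : R) : `|A| <= M ->
  frob_dot A A <= m%:R * n%:R * M ^+ 2.
Proof.
move=> AM; rewrite frob_dotE.
have entry i j : A i j * A i j <= M ^+ 2.
  have M0 : 0 <= M by exact: le_trans AM.
  rewrite -expr2 -real_normK ?num_real// ler_pXn2r ?nnegrE//.
  apply: le_trans AM; rewrite -[leRHS]/(mx_norm A) mx_normrE.
  exact: (le_bigmax _ (fun ij => `|A ij.1 ij.2|) (i, j)).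
have -> : m%:R * n%:R * M ^+ 2 = \sum_(i < m) \sum_(j < n) M ^+ 2.
  by rewrite !sumr_const !card_ord -mulrnA [in RHS]mulnC -natrM mulr_natl.
by apply: ler_sum => i _; apply: ler_sum => j _.
Qed.

Lemma frob_boundedP (u : nat -> 'M[R]_(m, n)) (M : R) :
  (forall k, frob_dot (u k) (u k) <= M) -> frob_bounded u.
Proof. by move=> uM; exists (Num.sqrt M) => k; rewrite ler_wsqrtr. Qed.

End Convexity.

End Frobenius.

(** * The soft polar factor *)

Section SoftPolar.
Context {R : realType} (m n : nat) (eps : R).
Context (eps_gt0 : 0 < eps).
Implicit Types H : 'M[R]_(m, n).

Definition soft_polar H : 'M[R]_(m, n) :=
  inv_sqrt (H *m H^T + (eps ^+ 2)%:M) *m H.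

Lemma spd_reg_gram H : spd (H *m H^T + (eps ^+ 2)%:M).
Proof.
split=> [|v v0].
  by rewrite linearD /= trmx_mul trmxK tr_scalar_mx.
have trE k (w : 'cV[R]_k) : (w^T *m w) 0 0 = frob_dot w w.
  by rewrite /frob_dot mxtrace_mulC /mxtrace big_ord1.
rewrite mulmxDr mulmxDl mxE ltr_wpDl//.
  have -> : v^T *m (H *m H^T) *m v = (H^T *m v)^T *m (H^T *m v).
    by rewrite trmx_mul trmxK !mulmxA.
  by rewrite trE frob_ge0.
rewrite mul_mx_scalar -scalemxAl mxE mulr_gt0 ?gram_gt0//.
by rewrite exprn_gt0.
Qed.

Lemma soft_polar_factor H : exists S : 'M[R]_m,
  [/\ spd S, S *m S = H *m H^T + (eps ^+ 2)%:M & S *m soft_polar H = H].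
Proof.
have [spdS S2] := spd_sqrtP (spd_reg_gram H).
exists (spd_sqrt (H *m H^T + (eps ^+ 2)%:M)); split=> //.
by rewrite mulKVmx// spd_unitmx.
Qed.

(** In terms of the singular values s of H this is the sum of the inequalities
    s^2 / sqrt (s^2 + eps^2) >= eps s^2 / (s^2 + eps^2).  The proof avoids
    singular values.  With X = S^-1 P, Cauchy-Schwarz for the form of S gives
    |P|^4 = <S X, P>^2 <= <P, X> <H, P>, since S X = P and S P = H.  Moreover
    <P, X> <= |P| |X| <= |P|^2 / eps, because
    |P|^2 = |S X|^2 = |H^T X|^2 + eps^2 |X|^2. *)
Lemma soft_polar_dot_ge H :
  eps * frob_dot (soft_polar H) (soft_polar H) <= frob_dot H (soft_polar H).
Proof.
have [S [spdS S2 SP]] := soft_polar_factor H; have [symS _] := spdS.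
set P := soft_polar H in SP *.
pose X := invmx S *m P.
have SX : S *m X = P by rewrite mulKVmx// spd_unitmx.
have PP : frob_dot P P = frob_dot (H^T *m X) (H^T *m X) + eps ^+ 2 * frob_dot X X.
  rewrite -[in LHS]SX frob_dotMl symS mulmxA S2 mulmxDl frob_dotDr mul_scalar_mx.
  rewrite frob_dotZr; congr (_ + _).
  by rewrite frob_dotMl trmxK mulmxA.
have psd (Z : 'M[R]_(m, n)) : 0 <= frob_dot (S *m Z) Z by exact: spd_frob_ge0.
have := psd_cauchy_schwarz X P symS psd.
rewrite SX SP => cs1.
have cs2 := frob_cauchy_schwarz P X.
have X2 : eps ^+ 2 * frob_dot X X <= frob_dot P P by rewrite PP lerDr frob_ge0.
have y0 := psd X; have z0 := psd P; rewrite SX in y0; rewrite SP in z0.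
have p0 := frob_ge0 P.
move: cs1 cs2 X2 y0 z0 p0.
move: (frob_dot P P) (frob_dot P X) (frob_dot H P) (frob_dot X X) => p y z w.
move=> cs1 cs2 X2 y0 z0 p0.
have yp : eps * y <= p.
  rewrite -(@ler_pXn2r _ 2)// ?nnegrE ?mulr_ge0 ?(ltW eps_gt0)// exprMn.
  apply: (le_trans (ler_wpM2l (exprn_ge0 2 (ltW eps_gt0)) cs2)).
  by rewrite mulrCA expr2 ler_wpM2l.
have [->|pn0] := eqVneq p 0; first by rewrite mulr0.
have p_gt0 : 0 < p by rewrite lt_def pn0.
rewrite -(ler_pM2l p_gt0) mulrCA -expr2.
apply: (le_trans (ler_wpM2l (ltW eps_gt0) cs1)).
by rewrite mulrA ler_wpM2r.
Qed.

(** H = S P, and |S|^2 = tr (H H^T + eps^2 I).  It lets a small soft polar factor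
    force H to be small, as long as H stays bounded. *)
Lemma soft_polar_inv_bound H :
  frob_dot H H <=
  (frob_dot H H + m%:R * eps ^+ 2) * frob_dot (soft_polar H) (soft_polar H).
Proof.
have [S [[symS _] S2 SP]] := soft_polar_factor H.
have -> : frob_dot H H + m%:R * eps ^+ 2 = frob_dot S S.
  by rewrite [RHS]/frob_dot symS S2 mxtraceD mxtrace_scalar mulr_natl.
by rewrite -[in leLHS]SP frob_mulmx_le.
Qed.

End SoftPolar.

(** * Smooth functions *)

Section Smooth.
Context {R : realType} (m n : nat).
Context (f : 'M[R]_(m, n) -> R) (L : R).
Context (fL : L_smooth L f) (L_gt0 : 0 < L).

Lemma grad_lipschitz_sqr (x h : 'M[R]_(m, n)) :
  frob_dot (grad f (x + h) - grad f x) (grad f (x + h) - grad f x) <=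
  L ^+ 2 * frob_dot h h.
Proof.
have xh : x + h - x = h by rewrite addrAC subrr add0r.
have := fL.2 (x + h) x; move: (grad f (x + h)) (grad f x) => a b; rewrite xh.
rewrite -!frob_normX2 -exprMn => le_ab.
by rewrite ler_pXn2r ?nnegrE ?mulr_ge0 ?sqrtr_ge0 ?(ltW L_gt0).
Qed.

(** The difference quotients of s |-> f (x + s h) at t are those of f at x + t h
    in the direction h. *)
Lemma derive_along_line (x h : 'M[R]_(m, n)) (t : R) :
  is_derive t 1 (fun s : R => f (x + s *: h)) (frob_dot (grad f (x + t *: h)) h).
Proof.
have df := fL.1 (x + t *: h).
have : derivable f (x + t *: h) h by exact: diff_derivable.
rewrite -diff_grad -(deriveE _ df) /derivable /derive.
pose fl (s : R) := f (x + s *: h).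
have -> :
  (fun a : R => a^-1 *: ((f \o shift (x + t *: h)) (a *: h) - f (x + t *: h))) =
  (fun a : R => a^-1 *: ((fl \o shift t) (a *: (1 : R)) - fl t)).
  apply/funext => a /=; congr (_ *: (f _ - _)).
  by rewrite scalerDl addrCA; congr (_ + _); rewrite scaler1.
by move=> ?; apply: DeriveDef.
Qed.

(** By the mean value theorem f (x + h) - f x is the inner product of h with the
    gradient at an intermediate point, which differs from the gradient at x by at
    most L |h|.  The constant L, instead of the sharp L / 2, only changes the
    range of admissible step sizes. *)
Lemma smooth_descent (x h : 'M[R]_(m, n)) :
  f (x + h) <= f x + frob_dot (grad f x) h + L * frob_dot h h.
Proof.
have cont : {within `[0, 1], continuous (fun s : R => f (x + s *: h))}.
  apply: derivable_within_continuous => t _.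
  by have [] := derive_along_line x h t.
have [c] := MVT_segment ler01 (fun t _ => derive_along_line x h t) cont.
rewrite in_itv/= => /andP[c0 c1].
rewrite scale1r scale0r addr0 subr0 mulr1 => fE.
suff : frob_dot (grad f (x + c *: h) - grad f x) h <= L * frob_dot h h.
  move=> grad_le; rewrite -[f (x + h)](subrK (f x)) fE.
  rewrite -[in leLHS](subrK (grad f x) (grad f _)).
  by rewrite frob_dotDl [leLHS]addrC addrA [leLHS]addrAC lerD2l.
have := grad_lipschitz_sqr x (c *: h).
move: (grad f (x + c *: h) - grad f x) => d.
rewrite frob_dotZl frob_dotZr => lip; have cs := frob_cauchy_schwarz d h.
have h0 := frob_ge0 h.
apply: le_trans (ler_norm _) _.
rewrite -(@ler_pXn2r _ 2)// ?nnegrE ?mulr_ge0 ?(ltW L_gt0)// real_normK ?num_real//.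
apply: (le_trans cs); rewrite exprMn [X in _ <= _ * X]expr2 mulrA ler_wpM2r//.
apply: (le_trans lip); rewrite ler_wpM2l ?exprn_ge0 ?(ltW L_gt0)//.
by rewrite mulrA -expr2 ler_piMl// exprn_ile1.
Qed.

End Smooth.

(** * The Lyapunov argument *)

(** The arithmetic of one step, with a for alpha, b for 1 - beta, f and f' for
    consecutive objective values, q and q' for consecutive squared momentum
    errors, and p for the squared norm of the soft polar factor.  The weight
    r = a / (eps b) makes the contraction of q gain r b q = a q / eps, twice what
    the term <e, P> costs.  What remains of the coefficient of a p is
    eps / 2 - a L - (a L)^2 / (eps b^2) >= eps / 2 - eps / 8 - eps / 64. *)
Lemma lyapunov_scalar (R : realFieldType) (eps a L b f f' p q q' r : R) :
  0 < eps -> 0 < a -> 0 < L -> 0 < b -> b <= 1 -> a * L <= eps * b / 8 ->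
  0 <= p ->
  f' <= f - a * (eps * p - (q / eps + eps * p) / 2) + L * (a ^+ 2 * p) ->
  q' <= (1 - b) * q + (L ^+ 2 * (a ^+ 2 * p)) / b ->
  r = a / (eps * b) ->
  f' + r * q' <= f + r * q - a * (eps / 4 * p + q / (2 * eps)).
Proof.
move=> eps0 a0 L0 b0 b1 aL p0 f'le q'le rE.
have r0 : 0 <= r by rewrite rE divr_ge0 ?ltW// mulr_gt0.
have := lerD f'le (ler_wpM2l r0 q'le).
set u := a * L in aL; have u0 : 0 < u by rewrite mulr_gt0.
have -> : f - a * (eps * p - (q / eps + eps * p) / 2) + L * (a ^+ 2 * p) +
   r * ((1 - b) * q + L ^+ 2 * (a ^+ 2 * p) / b) =
   f + r * q - a * (eps / 4 * p + q / (2 * eps)) -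
   a * p * (eps / 4 - u - u ^+ 2 / (eps * b ^+ 2)).
  by rewrite rE /u; field; rewrite !gt_eqF.
move=> /le_trans; apply; rewrite gerBl !mulr_ge0 ?(ltW a0)//.
have ub : u <= eps / 8 by nra.
suff : u ^+ 2 / (eps * b ^+ 2) <= eps / 8 by lra.
rewrite ler_pdivrMr ?mulr_gt0 ?exprn_gt0//.
have : u ^+ 2 <= (eps * b / 8) ^+ 2.
  by rewrite ler_pXn2r ?nnegrE// ?(ltW u0)// (le_trans (ltW u0)).
have -> : (eps * b / 8) ^+ 2 = eps / 8 * (eps * b ^+ 2) / 8 by field.
have : 0 <= eps / 8 * (eps * b ^+ 2) by rewrite !mulr_ge0 ?invr_ge0 ?exprn_ge0 ?ltW.
lra.
Qed.

Lemma cvg_scaled_decrement (R : realType) (u : R ^nat) (c : R) :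
  cvgn u -> c * (u k - u k.+1) @[k --> \oo] --> (0 : R).
Proof.
move=> ucvg; rewrite -(mulr0 c) -(subrr (limn u)).
have ucvgS : u k.+1 @[k --> \oo] --> limn u by rewrite cvg_shiftS.
exact: cvgM (cvg_cst c) (cvgB ucvg ucvgS).
Qed.

Section SoftMuonConvergence.
Context {R : realType} (m n : nat) (f : 'M[R]_(m, n) -> R) (L eps alpha beta : R).
Context (x0 : 'M[R]_(m, n)) (x H : nat -> 'M[R]_(m, n)).
Context (L_gt0 : 0 < L) (eps_gt0 : 0 < eps) (alpha_gt0 : 0 < alpha).
Context (beta_ge0 : 0 <= beta) (beta_lt1 : beta < 1).
Context (fL : L_smooth L f) (sm : soft_muon f eps alpha beta x0 x H).
Context (alphaL : alpha * L <= eps * (1 - beta) / 8).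

Local Notation g k := (grad f (x k)).
Let step k := soft_polar eps (H k.+1).
Let err k := H k.+1 - g k.
Let sq (A : 'M[R]_(m, n)) := frob_dot A A.
Let V k := f (x k) + alpha / (eps * (1 - beta)) * sq (err k).

Lemma iterateS k : x k.+1 = x k + - alpha *: step k.
Proof. by have [_ _ _ ->] := sm; rewrite scaleNr. Qed.

Lemma error0 : err 0 = 0.
Proof.
have [x00 H0 HS _] := sm.
by rewrite /err HS H0 x00 -scalerDl subrKC scale1r subrr.
Qed.

(** The new error is beta (e_k + g_k - g_(k+1)).  Writing it as a convex
    combination of e_k and a multiple of the gradient increment keeps the factor
    beta < 1 in front of the old squared error, at the price of 1 / (1 - beta) in
    front of the squared increment. *)
Lemma sq_errorS k : sq (err k.+1) <=
  beta * sq (err k) + L ^+ 2 * (alpha ^+ 2 * sq (step k)) / (1 - beta).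
Proof.
have b0 : 0 < 1 - beta by rewrite subr_gt0.
have -> : err k.+1 = beta *: err k +
    (1 - beta) *: ((- beta / (1 - beta)) *: (g k.+1 - g k)).
  have [_ _ HS _] := sm; rewrite /err (HS k.+1) scalerA.
  rewrite mulrCA mulfV ?gt_eqF// mulr1.
  move: (H k.+1) (g k) (g k.+1) => h a b.
  apply/matrixP => i j; rewrite !mxE; ring.
have le1 := frob_convex (err k) ((- beta / (1 - beta)) *: (g k.+1 - g k)).
apply: le_trans (le1 beta _) _; first by rewrite beta_ge0 ltW.
rewrite lerD2l frob_dotZl frob_dotZr.
have := grad_lipschitz_sqr fL L_gt0 (x k) (- alpha *: step k).
rewrite -iterateS frob_dotZl frob_dotZr -/(sq (step k)) -/(sq _).
rewrite -/(sq (g k.+1 - g k)).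
have := frob_ge0 (g k.+1 - g k); rewrite -/(sq _).
move: (sq (g k.+1 - g k)) (sq (step k)) => d p d0 dp.
have -> : (1 - beta) * (- beta / (1 - beta) * (- beta / (1 - beta) * d)) =
    beta ^+ 2 * d / (1 - beta) by field; rewrite gt_eqF.
rewrite ler_pM2r ?invr_gt0//.
apply: (@le_trans _ _ d); first by rewrite ler_piMl// exprn_ile1// ltW.
by apply: le_trans dp _; rewrite le_eqVlt; apply/orP; left; apply/eqP; ring.
Qed.

(** Since g_k = H_(k+1) - e_k, the first-order term of the descent inequality is
    -alpha <H_(k+1), P> + alpha <e_k, P>; the first part is controlled by
    soft_polar_dot_ge and the second by Young's inequality with weight eps. *)
Lemma lyapunov_decrease k :
  V k.+1 <= V k - alpha * (eps / 4 * sq (step k) + sq (err k) / (2 * eps)).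
Proof.
have b0 : 0 < 1 - beta by rewrite subr_gt0.
apply: (@lyapunov_scalar _ eps alpha L (1 - beta)) => //.
- by rewrite gerBl.
- exact: frob_ge0.
- have := smooth_descent fL L_gt0 (x k) (- alpha *: step k).
  rewrite -iterateS 2!frob_dotZr frob_dotZl -/(sq (step k)).
  have := soft_polar_dot_ge eps_gt0 (H k.+1); rewrite -/(step k) -/(sq _).
  have := frob_young (err k) (step k) eps_gt0; rewrite -/(sq _) -/(sq (step k)).
  have -> : frob_dot (H k.+1) (step k) =
      frob_dot (err k) (step k) + frob_dot (g k) (step k).
    by rewrite -frob_dotDl subrK.
  move: (f (x k.+1)) (f (x k)) (sq (step k)) (sq (err k)) (frob_dot (err k) _)
    (frob_dot (g k) _) => f1 f0 p q ep gp young ge_p desc.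
  apply: le_trans desc _.
  have -> : L * (- alpha * (- alpha * p)) = L * (alpha ^+ 2 * p) by ring.
  rewrite lerD2r lerD2l mulNr lerN2 ler_pM2l//; lra.
- by rewrite subKr; exact: sq_errorS.
Qed.

Context (xstar : 'M[R]_(m, n)) (fmin : global_minimizer f xstar).
Context (fproper : proper_fun f).

Lemma decrease_ge0 k : 0 <= alpha * (eps / 4 * sq (step k) + sq (err k) / (2 * eps)).
Proof.
have := frob_ge0 (step k); have := frob_ge0 (err k); rewrite -!/(sq _) => q0 p0.
by rewrite mulr_ge0 ?(ltW alpha_gt0)// addr_ge0// ?mulr_ge0 ?invr_ge0 ?mulr_ge0 ?(ltW eps_gt0).
Qed.

Lemma lyapunov_nonincreasing : {homo V : i j / (i <= j)%N >-> j <= i}.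
Proof.
apply/nonincreasing_seqP => k; apply: le_trans (lyapunov_decrease k) _.
by rewrite gerBl decrease_ge0.
Qed.

Lemma f_le_lyapunov k : f (x k) <= V k.
Proof.
rewrite lerDl mulr_ge0 ?frob_ge0// divr_ge0 ?(ltW alpha_gt0)// mulr_ge0 ?(ltW eps_gt0)//.
by rewrite subr_ge0 ltW.
Qed.

(** The initial error vanishes, so V starts exactly at f (x 0): the sublevel set
    that contains the trajectory is the initial one. *)
Lemma f_iterate_le k : f (x k) <= f (x 0).
Proof.
apply: le_trans (f_le_lyapunov k) _; apply: le_trans (lyapunov_nonincreasing (leq0n k)) _.
by rewrite /V error0 /sq /frob_dot mul0mx mxtrace0 mulr0 addr0.
Qed.

Lemma iterates_bounded : exists M, forall k, sq (x k) <= M.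
Proof.
have K : compact (f @^-1` `[f xstar, f (x 0)]).
  by apply: fproper; exact: segment_compact.
have [M [_ xM]] := compact_bounded K.
exists (m%:R * n%:R * (M + 1) ^+ 2) => k; apply: frob_normr_bound.
by apply: xM; rewrite ?ltrDl//= in_itv/= fmin f_iterate_le.
Qed.

Lemma gradients_bounded : exists M, forall k, sq (g k) <= M.
Proof.
have [M xM] := iterates_bounded.
exists (2 * (L ^+ 2 * M) + 2 * sq (grad f 0)) => k.
rewrite -[g k](subrK (grad f 0)); apply: le_trans (frob_addr_le _ _) _.
rewrite lerD2r ler_pM2l//.
have := grad_lipschitz_sqr fL L_gt0 0 (x k); rewrite add0r => /le_trans; apply.
by rewrite ler_pM2l ?exprn_gt0//; exact: xM.
Qed.

Lemma momentum_bounded_by M : (forall k, sq (g k) <= M) -> forall k, sq (H k) <= M.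
Proof.
move=> gM; have [x00 H0 HS _] := sm; elim=> [|k IH].
  by rewrite H0 -x00.
rewrite HS; apply: le_trans (frob_convex _ _ _) _; first by rewrite beta_ge0 ltW.
have -> : M = beta * M + (1 - beta) * M by ring.
by apply: lerD; rewrite ler_wpM2l// ?subr_ge0 ?(ltW beta_lt1)//; exact: gM.
Qed.

(** The squared gradient is at most 2 |H_(k+1)|^2 + 2 q_k <= 2 B p_k + 2 q_k, with
    B a bound on |H|^2 + m eps^2; this is a constant multiple of the decrement of
    the convergent sequence V. *)
Lemma sq_grad_cvg0 : sq (g k) @[k --> \oo] --> (0 : R).
Proof.
have [M gM] := gradients_bounded; have HM := momentum_bounded_by gM.
have M0 : 0 <= M by exact: le_trans (frob_ge0 _) (gM 0).
have Vcvg : cvgn V.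
  apply: nonincreasing_is_cvgn; first exact: lyapunov_nonincreasing.
  by exists (f xstar) => _ [k _ <-]; exact: le_trans (fmin _) (f_le_lyapunov k).
pose B := M + m%:R * eps ^+ 2.
have B0 : 0 <= B by rewrite addr_ge0// mulr_ge0// exprn_ge0// ltW.
(* C times the decrease alpha (eps p / 4 + q / (2 eps)) is at least
   2 B p + 2 q. *)
pose C := 8 * B / (alpha * eps) + 4 * eps / alpha.
have C0 : 0 <= C.
  by rewrite addr_ge0// divr_ge0 ?mulr_ge0 ?(ltW alpha_gt0) ?(ltW eps_gt0).
have bound k : 0 <= sq (g k) <= C * (V k - V k.+1).
  rewrite frob_ge0/=.
  have decr : alpha * (eps / 4 * sq (step k) + sq (err k) / (2 * eps)) <=
      V k - V k.+1.
    move: (lyapunov_decrease k).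
    by move: (V k.+1) (V k) (alpha * _) => v' v d; lra.
  apply: le_trans (ler_wpM2l C0 decr).
  have p0 := frob_ge0 (step k); have q0 := frob_ge0 (err k).
  have HB : sq (H k.+1) <= B * sq (step k).
    apply: le_trans (soft_polar_inv_bound eps_gt0 _) _.
    by rewrite ler_wpM2r// lerD2r HM.
  have : sq (g k) <= 2 * sq (H k.+1) + 2 * sq (err k).
    have -> : g k = H k.+1 + - 1 *: err k by rewrite scaleN1r subKr.
    apply: le_trans (frob_addr_le _ _) _.
    by rewrite frob_dotZl frob_dotZr !mulN1r opprK.
  move/le_trans; apply.
  move: p0 q0 HB; rewrite -!/(sq _).
  move: (sq (H k.+1)) (sq (step k)) (sq (err k)) => h p q p0 q0 hp.
  rewrite -subr_ge0.
  have -> : C * (alpha * (eps / 4 * p + q / (2 * eps))) - (2 * h + 2 * q) =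
      2 * (B * p - h) + eps ^+ 2 * p + 4 * B / eps ^+ 2 * q.
    by rewrite /C; field; rewrite !gt_eqF.
  by rewrite !addr_ge0// !mulr_ge0 ?invr_ge0 ?exprn_ge0 ?subr_ge0 ?(ltW eps_gt0).
apply: (squeeze_cvgr (f := fun=> 0) (h := fun k => C * (V k - V k.+1))).
- by near=> k; exact: bound.
- exact: cvg_cst.
- exact: cvg_scaled_decrement.
Unshelve. all: by end_near. Qed.

End SoftMuonConvergence.

Theorem corollary2 (R : realType) (m n : nat) (hm : (0 < m)%N) (hmn : (m <= n)%N)
  (f : 'M[R]_(m, n) -> R) (hproper : proper_fun f)
  (L : R) (hL : 0 < L) (hsmooth : L_smooth L f)
  (xstar : 'M[R]_(m, n)) (hmin : global_minimizer f xstar)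
  (huniq : forall y : 'M[R]_(m, n), global_minimizer f y -> y = xstar)
  (mu : R) (hmu : 0 < mu) (hPL : PL_ineq mu f (f xstar))
  (eps : R) (heps : 0 < eps) (x0 : 'M[R]_(m, n)) (beta : R)
  (hbeta0 : 0 <= beta) (hbeta : beta < 1 / Num.sqrt 2) :
  exists alphabar : R, 0 < alphabar /\
    forall alpha : R, 0 < alpha -> alpha < alphabar ->
    forall x H : nat -> 'M[R]_(m, n), soft_muon f eps alpha beta x0 x H ->
      [/\ frob_bounded x,
          frob_bounded H &
          frob_norm (grad f (x k)) @[k --> \oo] --> (0 : R)].
Proof.
have beta1 : beta < 1.
  apply: lt_le_trans hbeta _; rewrite div1r invf_le1 ?sqrtr_gt0//.
  by rewrite -[leLHS]sqrtr1 ler_wsqrtr// ler1n.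
exists (eps * (1 - beta) / 8 / L); split.
  by rewrite !divr_gt0 ?mulr_gt0 ?subr_gt0.
move=> alpha alpha0; rewrite ltr_pdivlMr// => /ltW alphaL x H sm; split.
- have [M xM] := iterates_bounded hL heps alpha0 hbeta0 beta1 hsmooth sm alphaL hmin hproper.
  exact: frob_boundedP xM.
- have [M gM] := gradients_bounded hL heps alpha0 hbeta0 beta1 hsmooth sm alphaL hmin hproper.
  by apply: frob_boundedP (momentum_bounded_by hbeta0 beta1 sm gM).
- have := sq_grad_cvg0 hL heps alpha0 hbeta0 beta1 hsmooth sm alphaL hmin hproper.
  move/(continuous_cvg _ (@sqrt_continuous R 0)).
  by rewrite sqrtr0.
Qed.
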